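(* For each integer $d\ge2$ let $b(1/2)=(b(1/2)_0,\dots,b(1/2)_d)\in\mathcal{D}_d$ be the probability mass function of the binomial distribution with $d$ trials and success probability $1/2$, and let $p^M=(p^M_0,\dots,p^M_d)\in\mathcal{D}_d$ be given by $p^M_k=\frac{\binom{d}{k}-1}{2^d-d-1}$. Then $$\lim_{d\to\infty}d_S(b(1/2),p^M)=0,$$ and, with $l^M=\mathcal{H}^{2^d-d-1}(\mathcal{P}(p^M))$ (which depends on $d$), $$\lim_{d\to\infty}\left(\mathcal{H}^{2^d-d-1}(\mathcal{P}(b(1/2)))-l^M\right)=0.$$
   Context: $\mathcal{D}_d$ is the simplex of probability mass functions $p=(p_0,\dots,p_d)$ on $\{0,\dots,d\}$. For $p,\tilde p\in\mathcal{D}_d$, $d_S(\tilde p,p)=\max_{0\le k\le d}|\tilde p_k-p_k|$. For $p\in\mathcal{D}_d$, $\mathcal{P}(p)\subset\mathbb{R}^{2^d}$ is the set of probability mass functions $f=(f(x))_{x\in\{0,1\}^d}$ on $\{0,1\}^d$ such that, if $(X_1,\dots,X_d)$ has probability mass function $f$, then $\sum_{i=1}^dX_i$ has probability mass function $p$. $\mathcal{H}^n$ is the $n$-dimensional Hausdorff measure, normalized to agree with Lebesgue measure on $\mathbb{R}^n$. The probability mass function $p^M$ (the ''maximal pmf'') is the maximizer of $p\mapsto\mathcal{H}^{2^d-d-1}(\mathcal{P}(p))$ over $\mathcal{D}_d$. *)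

(* Defs.v *)
From HB Require Import structures.
From mathcomp Require Import all_boot all_order all_algebra.
From mathcomp Require Import all_classical all_reals all_analysis.

Set Implicit Arguments.
Unset Strict Implicit.
Unset Printing Implicit Defensive.

Import Order.TTheory GRing.Theory Num.Theory.
Import numFieldNormedType.Exports.

Local Open Scope classical_set_scope.
Local Open Scope ring_scope.

Section Hausdorff.
Context {R : realType}.

(* Volume of the unit ball of R^n, i.e. pi^(n/2) / Gamma(n/2 + 1), through the
   recursion omega_(n+2) = 2 pi / (n+2) * omega_n. *)
Fixpoint ball_volume (n : nat) : R :=
  match n with
  | 0 => 1
  | 1 => 2
  | (m.+2 as k) => 2 * pi / k%:R * ball_volume m
  end.

(* The Hausdorff measure is taken for the Euclidean distance; the norm which
   the library puts on spaces of matrices is the sup norm. *)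
Definition euclidean_dist (I : finType) (f g : {ffun I -> R}) : R :=
  Num.sqrt (\sum_i (f i - g i) ^+ 2).

(* The added 0 only matters for the empty set, whose diameter is 0. *)
Definition diam (I : finType) (U : set {ffun I -> R}) : \bar R :=
  ereal_sup (0%E |` [set (euclidean_dist z.1 z.2)%:E | z in U `*` U]).

(* The constant ball_volume n / 2 ^+ n makes the n-dimensional Hausdorff
   measure on R^n equal to Lebesgue measure, by the isodiametric inequality.
   The empty set is separated because of the convention x ^+ 0 = 1: it must
   not contribute to the 0-dimensional (counting) measure. *)
Definition hausdorff_gauge (n : nat) (I : finType) (U : set {ffun I -> R}) :
    \bar R :=
  if U == set0 then 0%E
  else ((ball_volume n / 2 ^+ n)%:E * diam U ^+ n)%E.

Definition hausdorff_premeasure (n : nat) (delta : R) (I : finType)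
    (A : set {ffun I -> R}) : \bar R :=
  ereal_inf [set (\sum_(0 <= j <oo) hausdorff_gauge n (U j))%E
            | U in [set U : nat -> set {ffun I -> R} |
                (forall j, (diam (U j) <= delta%:E)%E) /\
                A `<=` \bigcup_j U j]].

Definition hausdorff_measure (n : nat) (I : finType)
    (A : set {ffun I -> R}) : \bar R :=
  ereal_sup [set hausdorff_premeasure n delta A
            | delta in [set delta : R | 0 < delta]].

End Hausdorff.

Section Pmf.
Context {R : realType}.

Definition is_pmf (T : finType) (f : {ffun T -> R}) : Prop :=
  (forall x, 0 <= f x) /\ \sum_x f x = 1.

Section FixedDimension.
Variable d : nat.

Definition simplex_dist (q p : {ffun 'I_d.+1 -> R}) : R :=
  \big[Num.max/0]_(k < d.+1) `|q k - p k|.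

(* Pmf of X_1 + ... + X_d when (X_1, ..., X_d) has pmf f on {0,1}^d. *)
Definition sum_pmf (f : {ffun {ffun 'I_d -> bool} -> R}) :
    {ffun 'I_d.+1 -> R} :=
  [ffun k : 'I_d.+1 =>
    \sum_(x : {ffun 'I_d -> bool} | (\sum_(i < d) x i)%N == k) f x].

Definition pmfs_with_sum (p : {ffun 'I_d.+1 -> R}) :
    set {ffun {ffun 'I_d -> bool} -> R} :=
  [set f | is_pmf f /\ sum_pmf f = p].

(* pmfs_with_sum p is cut out by d + 1 independent affine equations in
   R^(2^d), whence the dimension. *)
Definition pmfs_volume (p : {ffun 'I_d.+1 -> R}) : \bar R :=
  hausdorff_measure (2 ^ d - d - 1)%N (pmfs_with_sum p).

End FixedDimension.

Definition binomial_half (d : nat) : {ffun 'I_d.+1 -> R} :=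
  [ffun k : 'I_d.+1 => binomial_pmf d (2^-1) k].

Definition maximal_pmf (d : nat) : {ffun 'I_d.+1 -> R} :=
  [ffun k : 'I_d.+1 => ('C(d, k)%:R - 1) / (2 ^+ d - d%:R - 1)].

Lemma binomial_half_is_pmf d : is_pmf (binomial_half d).
Proof.
split=> [k|]; first by rewrite ffunE binomial_pmf_ge0// invr_ge0 ler0n invf_le1 ?ltr0n// ler1n.
transitivity ((2^-1 + unstable.onem 2^-1 : R) ^+ d); last by rewrite /unstable.onem addrC subrK expr1n.
rewrite addrC exprDn; apply: eq_bigr => k _.
by rewrite ffunE /binomial_pmf mulrC.
Qed.

Lemma maximal_pmf_is_pmf d : (2 <= d)%N -> is_pmf (maximal_pmf d).
Proof.
move=> d2.
have sumC : \sum_(k < d.+1) ('C(d, k)%:R : R) = 2 ^+ d.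
  rewrite -[2]/((1 + 1)%:R) natrD exprDn; apply: eq_bigr => k _.
  by rewrite !expr1n mulr1.
have E : 2 ^+ d - d%:R - 1 = \sum_(k < d.+1) ('C(d, k)%:R - 1 : R).
  by rewrite sumrB sumC sumr_const card_ord -addrA -opprD natr1.
have C1 (k : 'I_d.+1) : 0 <= ('C(d, k)%:R - 1 : R).
  by rewrite subr_ge0 ler1n bin_gt0 -ltnS.
have pos : 0 < \sum_(k < d.+1) ('C(d, k)%:R - 1 : R).
  have k1 : (1 < d.+1)%N by rewrite ltnS ltnW.
  rewrite (bigD1 (Ordinal k1))//= ltr_pwDl ?sumr_ge0// bin1.
  by rewrite subr_gt0 ltr1n.
split=> [k|]; first by rewrite ffunE E divr_ge0// ltW.
under eq_bigr do rewrite ffunE.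
by rewrite -mulr_suml -E divff// E gt_eqF.
Qed.

End Pmf.
Arguments binomial_half : clear implicits.
Arguments maximal_pmf : clear implicits.

(* Main.v *)
(** Both volumes tend to 0, uniformly over all pmfs: writing n = 2^d - d - 1, an
    element of P(p) is determined by its coordinates at n vertices (all but one
    in each level), which lie in the corner simplex {y >= 0, sum y <= 1} of
    R^n, of volume 1/n!. Recovering the remaining coordinates at most doubles
    the l^1 distance, so cells of a grid of mesh s pull back to sets of
    diameter at most 2 n s, and covering gives
    H^n(P(p)) <= omega_n (2 n)^n / n! <= omega_n e^(2n), which vanishes because
    the volume omega_n of the unit ball decays faster than any exponential. *)

Require Import Defs.
From mathcomp Require Import all_boot all_order all_algebra.
From mathcomp Require Import all_classical all_reals all_analysis.
From mathcomp Require Import zify ring lra.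
Set Implicit Arguments.
Unset Strict Implicit.
Unset Printing Implicit Defensive.
Import numFieldNormedType.Exports.
Import Order.TTheory GRing.Theory Num.Theory.
Local Open Scope classical_set_scope.
Local Open Scope ring_scope.

Lemma ffact_le_expn n m : (n ^_ m <= n ^ m)%N.
Proof.
elim: m => // m IH; rewrite ffactnSr expnSr.
by rewrite leq_mul// leq_subr.
Qed.

(** * Upper bounds for Hausdorff measure by explicit coverings *)

Section HausdorffBounds.
Context {R : realType}.
Implicit Types (I : finType) (r : R).

Lemma ball_volume_ge0 n : 0 <= ball_volume n :> R.
Proof.
suff: 0 <= ball_volume n :> R /\ 0 <= ball_volume n.+1 :> R by case.
elim: n => [|n [h0 h1]]; first by rewrite /= !ler0n.
split=> //; rewrite [ball_volume _]/= mulr_ge0// divr_ge0// mulr_ge0//.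
exact: pi_ge0.
Qed.

Lemma diam_ge0 I (U : set {ffun I -> R}) : (0 <= diam U)%E.
Proof. by apply: ereal_sup_ubound; left. Qed.

Lemma hausdorff_gauge_ge0 n I (U : set {ffun I -> R}) :
  (0 <= hausdorff_gauge n U)%E.
Proof.
rewrite /hausdorff_gauge; case: ifP => // _.
rewrite mule_ge0 ?expe_ge0 ?diam_ge0// lee_fin.
by rewrite divr_ge0 ?ball_volume_ge0 ?exprn_ge0.
Qed.

Lemma hausdorff_gauge_le n I (U : set {ffun I -> R}) r : 0 <= r ->
  (diam U <= r%:E)%E ->
  (hausdorff_gauge n U <= (ball_volume n / 2 ^+ n * r ^+ n)%:E)%E.
Proof.
move=> r0 Ur; have c0 : 0 <= ball_volume n / 2 ^+ n :> R.
  by rewrite divr_ge0 ?ball_volume_ge0 ?exprn_ge0.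
rewrite /hausdorff_gauge; case: ifP => _.
  by rewrite lee_fin mulr_ge0// exprn_ge0.
rewrite [leRHS]EFinM EFin_expe lee_wpmul2l ?lee_fin//.
elim: n {c0} => // n IH.
by rewrite !expeS lee_pmul ?diam_ge0// expe_ge0// diam_ge0.
Qed.

Lemma hausdorff_premeasure_ge0 n delta I (A : set {ffun I -> R}) :
  (0 <= hausdorff_premeasure n delta A)%E.
Proof.
apply: le_ereal_inf_tmp => _ [U _ <-].
by apply: nneseries_ge0 => k _ _; exact: hausdorff_gauge_ge0.
Qed.

Lemma hausdorff_measure_ge0 n I (A : set {ffun I -> R}) :
  (0 <= hausdorff_measure n A)%E.
Proof.
apply: le_ereal_sup_tmp; exists (hausdorff_premeasure n 1 A).
  by exists 1 => //=.
exact: hausdorff_premeasure_ge0.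
Qed.

(** The list is padded with empty sets to a sequence. Their gauge is 0 even for [n = 0], so the
    series reduces to its first [size s] terms. *)
Lemma hausdorff_premeasure_finite_cover n delta r I (A : set {ffun I -> R})
    (s : seq (set {ffun I -> R})) :
  0 <= r <= delta ->
  (forall U, U \in s -> (diam U <= r%:E)%E) ->
  (forall f, A f -> exists2 U, U \in s & U f) ->
  (hausdorff_premeasure n delta A <=
     ((size s)%:R * (ball_volume n / 2 ^+ n * r ^+ n))%:E)%E.
Proof.
move=> /andP[r0 rd] sr As; set u := _ * r ^+ n.
pose U j := nth set0 s j.
have U0 j : (size s <= j)%N -> U j = set0 by move=> h; rewrite /U nth_default.
have Ur j : (diam (U j) <= r%:E)%E.
  have [js|sj] := ltnP j (size s); first by apply: sr; rewrite mem_nth.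
  rewrite U0//; apply: ge_ereal_sup => _ [->|[[f g] [/= []]]//].
  by rewrite lee_fin.
have -> : ((size s)%:R * u)%:E = (\sum_(0 <= j < size s) u%:E)%E.
  by rewrite sumEFin big_mkord sumr_const card_ord mulr_natl.
apply: (@le_trans _ _ (\sum_(0 <= j <oo) hausdorff_gauge n (U j))%E).
  apply: ereal_inf_lbound; exists U => //; split.
    by move=> j; rewrite (le_trans (Ur j))// lee_fin.
  move=> f /As[V Vs Vf]; exists (index V s) => //.
  by rewrite /U nth_index.
rewrite (@nneseries_split _ _ 0%N (size s)); last first.
  by move=> *; exact: hausdorff_gauge_ge0.
rewrite add0n eseries0 ?adde0; last first.
  by move=> j sj _; rewrite U0// /hausdorff_gauge eqxx.
by apply: lee_sum => j _; exact: hausdorff_gauge_le.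
Qed.

(* The cells of a grid of mesh 1/N meeting the corner simplex are counted by
   'C(n + N, n), whose leading term N^n/n! provides the factor 1/n!. *)
Lemma hausdorff_measure_le_corner_simplex n I (A : set {ffun I -> R})
    (c : 'I_n -> I) (K : R) :
  0 <= K ->
  (forall f, A f -> (forall i, 0 <= f (c i)) /\ \sum_i f (c i) <= 1) ->
  (forall f g (s : R), A f -> A g ->
     (forall i, `|f (c i) - g (c i)| <= s) -> euclidean_dist f g <= K * s) ->
  (hausdorff_measure n A <= (ball_volume n * K ^+ n / n`!%:R)%:E)%E.
Proof.
move=> K0 Asimplex Alip.
apply: ge_ereal_sup => _ [delta /= delta0 <-].
pose N := maxn n.+1 (Num.truncn (K / delta)).+1.
have N0 : 0 < N%:R :> R by rewrite ltr0n leq_max.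
have KN : 0 <= K / N%:R <= delta.
  rewrite divr_ge0//= ler_pdivrMr// mulrC -ler_pdivrMr// ltW//.
  by rewrite (lt_le_trans (truncnS_gt _))// ler_nat leq_max leqnn orbT.
pose cell (t : n.-tuple 'I_N.+1) : set {ffun I -> R} :=
  [set f | A f /\ forall i, Num.truncn (N%:R * f (c i)) = tnth t i].
pose T := [set t : n.-tuple 'I_N.+1 | (\sum_(i <- t) i <= N)%N]%SET.
pose s := [seq cell t | t <- enum T].
apply: (le_trans (@hausdorff_premeasure_finite_cover n delta _ I A s KN _ _)).
- move=> _ /mapP[t _ ->]; apply: ge_ereal_sup => y [->|].
    by rewrite lee_fin; case/andP: KN.
  move=> [[f g] [/= [Af ft] [Ag gt]] <-{y}]; rewrite lee_fin.
  apply: Alip => // i.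
  have f0 := (Asimplex f Af).1 i; have g0 := (Asimplex g Ag).1 i.
  have := truncn_itv (mulr_ge0 (ltW N0) f0).
  have := truncn_itv (mulr_ge0 (ltW N0) g0).
  (* In a common cell, [N * f (c i)] and [N * g (c i)] both lie in [[m, m + 1)], so [f (c i)] and
     [g (c i)] differ by at most [1 / N]. *)
  rewrite ft gt -natr1; set m := (_%:R : R) => /andP[g1 g2] /andP[f1 f2].
  rewrite -[X in _ <= X]mul1r ler_pdivlMr// -[X in _ * X]gtr0_norm// -normrM.
  rewrite ler_norml; apply/andP; split; nra.
- move=> f Af; have [f0 f1] := Asimplex f Af.
  have sumN : (\sum_i Num.truncn (N%:R * f (c i)) <= N)%N.
    rewrite -(ler_nat R) natr_sum (@le_trans _ _ (\sum_i N%:R * f (c i)))//.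
      apply: ler_sum => i _.
      by have /andP[] := truncn_itv (mulr_ge0 (ltW N0) (f0 i)).
    by rewrite -mulr_sumr ger_pMr.
  have lt i : (Num.truncn (N%:R * f (c i)) < N.+1)%N.
    by rewrite ltnS (leq_trans _ sumN)// (bigD1 i)//= leq_addr.
  pose t := [tuple Ordinal (lt i) | i < n].
  exists (cell t); last by split=> // i; rewrite tnth_mktuple.
  apply/mapP; exists t => //; rewrite mem_enum inE big_tuple.
  by under eq_bigr do rewrite tnth_mktuple.
rewrite lee_fin size_map -cardE card_partial_ord_partitions.
have binN : 'C(n + N, n)%:R <= (2 * N%:R) ^+ n / n`!%:R :> R.
  rewrite ler_pdivlMr ?ltr0n ?fact_gt0// -!natrM bin_ffact -natrX ler_nat.
  rewrite (leq_trans (ffact_le_expn _ _))//.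
  have [->//|n0] := posnP n.
  by rewrite leq_exp2r// mul2n -addnn leq_add2r ltnW// leq_maxl.
apply: (le_trans (ler_wpM2r _ binN)).
  by rewrite !(mulr_ge0, invr_ge0, exprn_ge0, ball_volume_ge0).
(* The powers of [N] cancel, and the loss of [2 ^+ n] in [binN] is exactly offset by the [2 ^+ n] of
   the gauge: the bound no longer depends on [delta]. *)
rewrite le_eqVlt; apply/orP; left; apply/eqP.
rewrite !expr_div_n !exprMn; field.
by rewrite !gt_eqF ?exprn_gt0// ltr0n fact_gt0.
Qed.

Lemma euclidean_dist_le_sum I (f g : {ffun I -> R}) :
  euclidean_dist f g <= \sum_i `|f i - g i|.
Proof.
have h0 : 0 <= \sum_i `|f i - g i| by apply: sumr_ge0.
rewrite /euclidean_dist -[leRHS](ger0_norm h0) -sqrtr_sqr ler_wsqrtr//.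
rewrite expr2 mulr_suml; apply: ler_sum => i _.
rewrite -[_ ^+ 2]ger0_norm ?sqr_ge0// normrX expr2 ler_wpM2l//.
by rewrite (bigD1 i)//= lerDl sumr_ge0.
Qed.

End HausdorffBounds.

(** * Coordinates on the polytope of pmfs with a given sum *)

Section FreeVertices.
Variables (R : realType) (d : nat).
Local Notation V := {ffun 'I_d -> bool}.

Definition weight (x : V) : nat := (\sum_(i < d) x i)%N.

(** The representative of level [k], whose coordinate is recovered from the prescribed level sum. *)
Definition staircase (k : 'I_d.+1) : V := [ffun i : 'I_d => (i < k)%N].

Definition free_vertices : {set V} :=
  (~: [set staircase k | k : 'I_d.+1])%SET.

Lemma weight_le (x : V) : (weight x < d.+1)%N.
Proof.
rewrite ltnS -[leqRHS]card_ord -sum1_card leq_sum// => i _.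
by case: (x i).
Qed.

Lemma weight_staircase (k : 'I_d.+1) : weight (staircase k) = k.
Proof.
rewrite /weight -[RHS]card_ord -sum1_card (big_ord_widen d (fun=> 1%N)).
  rewrite [RHS]big_mkcond; apply: eq_bigr => i _.
  by rewrite ffunE; case: ifP.
by rewrite -ltnS.
Qed.

Lemma staircase_inj : injective staircase.
Proof.
by move=> k l /(congr1 weight); rewrite !weight_staircase => /ord_inj.
Qed.

Lemma card_free_vertices : #|free_vertices| = (2 ^ d - d - 1)%N.
Proof.
rewrite cardsCs finset.setCK card_imset ?card_ord; last exact: staircase_inj.
by rewrite card_ffun card_bool card_ord -subnDA addn1.
Qed.

(** On each level, [h] at the staircase vertex is minus its sum over the free vertices of that
    level. The triangle inequality then bounds all staircase terms together by a second copy of the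
    free sum. *)
Lemma sum_norm_free_vertices (h : V -> R) :
  (forall k : 'I_d.+1, \sum_(x | weight x == k) h x = 0) ->
  \sum_x `|h x| <= 2 * \sum_(x in free_vertices) `|h x|.
Proof.
move=> h0; rewrite (bigID [in free_vertices])/= mulr_natl mulr2n lerD2l.
rewrite (eq_bigl [in [set staircase k | k : 'I_d.+1]%SET]); last first.
  by move=> x; rewrite !inE negbK.
rewrite big_imset/=; last by move=> k l _ _; exact: staircase_inj.
rewrite [leRHS](partition_big (fun x => Ordinal (weight_le x)) predT)//=.
apply: ler_sum => k _.
have := h0 k; rewrite (bigD1 (staircase k)) ?weight_staircase//=.
move/eqP; rewrite addr_eq0 => /eqP ->; rewrite normrN.
rewrite (le_trans (ler_norm_sum _ _ _))// le_eqVlt; apply/orP; left; apply/eqP.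
(* A staircase of weight [k] can only be [staircase k], so the other vertices of level [k] are
   precisely its free ones. *)
apply: eq_bigl => x; rewrite -val_eqE/= andbC; case: (weight x =P k) => wx.
  rewrite !andbT inE; congr (~~ _); apply/eqP/imsetP => [->|[l _ xl]].
    by exists k.
  rewrite xl; congr staircase; apply: val_inj.
  by rewrite /= -wx xl weight_staircase.
by rewrite !andbF.
Qed.

Lemma pmfs_volume_ge0 (p : {ffun 'I_d.+1 -> R}) : (0 <= pmfs_volume p)%E.
Proof. exact: hausdorff_measure_ge0. Qed.

Lemma pmfs_volume_le (p : {ffun 'I_d.+1 -> R}) (n := (2 ^ d - d - 1)%N) :
  (pmfs_volume p <= (ball_volume n * (2 * n%:R) ^+ n / n`!%:R)%:E)%E.
Proof.
rewrite /pmfs_volume -/n.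
(* With the dimension turned into a cardinal, [enum_val] supplies the coordinate map. The constant
   [K] is [2 * n]: a factor 2 from the recovered coordinates, and [n] coordinate differences of size
   at most [s]. *)
have nE : #|free_vertices| = n := card_free_vertices.
move: n nE => _ <-.
apply: (@hausdorff_measure_le_corner_simplex _ _ _ _ (@enum_val _ _)).
- by rewrite mulr_ge0.
- move=> f [[f0 f1] _]; split=> //.
  rewrite -(big_enum_val (fun x => f x)) -f1.
  rewrite [leRHS](bigID [in free_vertices])/=.
  by rewrite lerDl sumr_ge0.
- move=> f g s [_ fp] [_ gp] fgs; apply: (le_trans (euclidean_dist_le_sum f g)).
  rewrite (le_trans (sum_norm_free_vertices (h := fun x => f x - g x) _))//.
    move=> k; rewrite sumrB; apply/eqP; rewrite subr_eq0; apply/eqP.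
    by move: fp; rewrite -gp => /ffunP/(_ k); rewrite !ffunE.
  rewrite -mulrA ler_wpM2l// big_enum_val.
  by rewrite (le_trans (ler_sum _ (fun i _ => fgs i)))//
    sumr_const card_ord mulr_natl.
Qed.

End FreeVertices.

(** * Decay of ball volumes *)

Section Limits.
Context {R : realType}.

(** Two-step induction: the factor [1 + 2 * q] covers the base values [1] and [2 * q], and passing
    from [m] to [m.+2] works because [2 * m./2.+1 <= m.+2]. *)
Lemma ball_volume_exp_le (q : R) n : 0 <= q ->
  ball_volume n * q ^+ n <= (1 + 2 * q) * ((pi * q ^+ 2) ^+ n./2 / n./2`!%:R).
Proof.
move=> q0; have pi0 : 0 <= pi :> R := pi_ge0 R.
suff: forall m, (ball_volume m * q ^+ m <=
    (1 + 2 * q) * ((pi * q ^+ 2) ^+ m./2 / m./2`!%:R)) /\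
  (ball_volume m.+1 * q ^+ m.+1 <=
    (1 + 2 * q) * ((pi * q ^+ 2) ^+ m.+1./2 / m.+1./2`!%:R)).
  by move=> /(_ n)[].
elim=> [|m [IH0 IH1]].
  by rewrite /= !expr0 divr1 expr1 !mulr1; split; lra.
split=> //; set u := (X in _ <= X).
have -> : ball_volume m.+2 * q ^+ m.+2 =
    2 * (pi * q ^+ 2) / m.+2%:R * (ball_volume m * q ^+ m).
  by rewrite [ball_volume m.+2]/= -[m.+2]addn2 exprD; field.
have -> : u = pi * q ^+ 2 / m./2.+1%:R *
    ((1 + 2 * q) * ((pi * q ^+ 2) ^+ m./2 / m./2`!%:R)).
  rewrite /u [m.+2./2]/= factS natrM exprSr; field.
  by rewrite nat1r !pnatr_eq0 -lt0n fact_gt0.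
apply: ler_pM => //.
- by rewrite !(mulr_ge0, exprn_ge0).
- by rewrite mulr_ge0 ?ball_volume_ge0 ?exprn_ge0.
rewrite mulrAC [leRHS]mulrC ler_wpM2r ?mulr_ge0 ?exprn_ge0//.
rewrite ler_pdivrMr// mulrC ler_pdivlMr// -natrM ler_nat mul2n doubleS !ltnS.
by rewrite -[leqRHS]odd_double_half leq_addl.
Qed.

Lemma cvg_ball_volume_exp (q : R) : 0 <= q ->
  ball_volume n * q ^+ n @[n --> \oo] --> 0.
Proof.
move=> q0.
apply: (@squeeze_cvgr _ _ _ _ (fun=> 0)
  (fun n => (1 + 2 * q) * ((pi * q ^+ 2) ^+ n./2 / n./2`!%:R))).
- near=> n; rewrite ball_volume_exp_le// andbT.
  by rewrite mulr_ge0 ?ball_volume_ge0 ?exprn_ge0.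
- exact: cvg_cst.
rewrite -[X in _ --> X](mulr0 (1 + 2 * q)); apply: cvgMl_tmp.
(* The bound is, up to a constant, the general term of the exponential series at [pi * q ^+ 2], read
   at index [n %/ 2]. *)
under eq_fun do rewrite -divn2.
apply: (@cvg_comp _ _ _ (fun n => n %/ 2)%N (exp_coeff (pi * q ^+ 2))).
  exact: cvg_divnr.
exact: cvg_exp_coeff.
Unshelve. all: by end_near. Qed.

(** * Growth of the dimension and the resulting estimates *)

Lemma bin_le_exp2n n m : ('C(n, m) <= 2 ^ n)%N.
Proof.
elim: n m => [|n IH] [|m] //; first by rewrite bin0 expn_gt0.
by rewrite binS expnS mul2n -addnn leq_add.
Qed.

(** The product is [d.+1 ^ 2 + d.+1], which leaves a full square once [d + 1] is subtracted. The
    threshold 6 is the first valid one: [56 <= 64], but [42 > 32] at 5. *)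
Lemma sqr_le_expn2 d : (6 <= d)%N -> (d.+1 * d.+2 <= 2 ^ d)%N.
Proof.
elim: d => // d IH; rewrite leq_eqVlt => /predU1P[[<-]//|]; rewrite ltnS => d6.
by have := IH d6; rewrite expnS; lia.
Qed.

Lemma sqr_le_free_dim d : (6 <= d)%N -> (d.+1 ^ 2 <= 2 ^ d - d - 1)%N.
Proof. by move=> /sqr_le_expn2; rewrite -mulnn; lia. Qed.

Lemma cvg_free_dim : (2 ^ d - d - 1)%N @[d --> \oo] --> \oo.
Proof.
apply/cvgnyPge => A; near=> d.
have d6 : (6 <= d)%N by near: d; exact: nbhs_infty_ge.
rewrite (leq_trans _ (sqr_le_free_dim d6))//.
have : (A <= d)%N by near: d; exact: nbhs_infty_ge.
by move=> /leq_trans; apply; rewrite (leq_trans (leqnSn d))// leq_pmulr.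
Unshelve. all: by end_near. Qed.

Definition pmfs_volume_bound (d : nat) : R :=
  let n := (2 ^ d - d - 1)%N in ball_volume n * (expR 2) ^+ n.

Lemma cvg_pmfs_volume_bound : pmfs_volume_bound d @[d --> \oo] --> 0.
Proof.
apply: (@cvg_comp _ _ _ (fun d => 2 ^ d - d - 1)%N
  (fun n => ball_volume n * expR 2 ^+ n)); first exact: cvg_free_dim.
exact/cvg_ball_volume_exp/expR_ge0.
Qed.

Lemma pmfs_volume_le_bound d (p : {ffun 'I_d.+1 -> R}) :
  (pmfs_volume p <= (pmfs_volume_bound d)%:E)%E.
Proof.
apply: (le_trans (pmfs_volume_le _)); rewrite lee_fin -mulrA /pmfs_volume_bound.
rewrite ler_wpM2l ?ball_volume_ge0// -expRM_natr.
(* [(2 * n) ^+ n / n!] is one term of the exponential series at [2 * n]; [expR_ge1Dxn] concerns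
   positive exponents, hence the separate case of dimension 0. *)
case: (_ - 1)%N => [|n]; first by rewrite !mulr0 expr0 divr1 expR0.
by rewrite (le_trans _ (expR_ge1Dxn n _)) ?lerDr// mulr_ge0.
Qed.

(** With [n] the dimension, each difference is [(2^d - (d+1) C) / (2^d n)] with [1 <= C <= 2^d]. It
    is at most [(d+1) / n] in absolute value, and [n >= (d+1)^2]. *)
Lemma simplex_dist_le d : (6 <= d)%N ->
  simplex_dist (binomial_half R d) (maximal_pmf R d) <= d.+1%:R^-1.
Proof.
move=> d6; apply: bigmax_le => [|k _]; first by rewrite invr_ge0.
rewrite !ffunE /binomial_pmf.
have -> : unstable.onem (2^-1 : R) = 2^-1 by rewrite /unstable.onem; field.
have kd : (k <= d)%N by rewrite -ltnS.
rewrite -exprD subnKC// exprVn -[_ *+ 'C(_, _)]mulr_natl.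
have := sqr_le_free_dim d6; rewrite -(ler_nat R).
(* Ensures that the natural subtraction in the dimension does not truncate, so that it casts to
   [R]. *)
have d2 : (d.+1 <= 2 ^ d)%N by exact: ltn_expl.
rewrite -subnDA addn1 natrB// natrX.
have -> : (2 ^ d)%:R - d.+1%:R = 2 ^+ d - d%:R - 1 :> R.
  by rewrite natrX -natr1; ring.
set n := 2 ^+ d - d%:R - 1 => dn.
have C1 : 1 <= 'C(d, k)%:R :> R by rewrite ler1n bin_gt0.
have C2 : 'C(d, k)%:R <= 2 ^+ d :> R.
  by rewrite -natrX ler_nat bin_le_exp2n.
have D0 : 1 <= d.+1%:R :> R by rewrite ler1n.
have n0 : 0 < n by rewrite (lt_le_trans _ dn)// exprn_gt0.
have t0 : 0 < 2 ^+ d :> R by rewrite exprn_gt0.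
have nE : 2 ^+ d = n + d.+1%:R by rewrite /n -natr1; ring.
have -> : 'C(d, k)%:R / 2 ^+ d - ('C(d, k)%:R - 1) / n =
    (2 ^+ d - d.+1%:R * 'C(d, k)%:R) / (2 ^+ d * n).
  move: t0; rewrite nE => t0; field.
  by rewrite nat1r !gt_eqF.
have num_le : `|2 ^+ d - d.+1%:R * 'C(d, k)%:R| <= d.+1%:R * 2 ^+ d :> R.
  by rewrite ler_norml; apply/andP; split; nra.
rewrite normrM normfV [`|_ * n|]gtr0_norm ?mulr_gt0//.
rewrite ler_pdivrMr ?mulr_gt0// (le_trans num_le)// mulrC mulrCA ler_pM2l//.
by rewrite mulrC ler_pdivlMr ?ltr0n// -expr2 -natrX.
Qed.

End Limits.

Theorem proposition4p2 (R : realType) :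
  (simplex_dist (binomial_half R d) (maximal_pmf R d)
     @[d --> \oo] --> (0 : R)) /\
  ((pmfs_volume (binomial_half R d) - pmfs_volume (maximal_pmf R d))%E
     @[d --> \oo] --> (0 : \bar R)%E).
Proof.
split.
  apply: (@squeeze_cvgr _ _ _ _ (fun=> 0) (@harmonic R)); last 2 first.
  - exact: cvg_cst.
  - exact: cvg_harmonic.
  near=> d; rewrite simplex_dist_le ?andbT//.
    exact: bigmax_ge_id.
  by near: d; exact: nbhs_infty_ge.
apply: (@squeeze_cvge _ _ _ _ (fun d => (- pmfs_volume_bound d)%:E) _
  (fun d => (pmfs_volume_bound d)%:E)); last 2 first.
- apply: cvg_EFin; first by near=> d.
  rewrite -[X in _ --> X]oppr0; exact: (cvgN cvg_pmfs_volume_bound).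
- apply: cvg_EFin; first by near=> d.
  exact: cvg_pmfs_volume_bound.
(* Both volumes lie between 0 and the same finite bound, so their difference is controlled without
   comparing them. *)
near=> d; apply/andP; split.
- by rewrite EFinN -[leLHS]add0e leeB ?pmfs_volume_ge0 ?pmfs_volume_le_bound.
- by rewrite -[leRHS]sube0 leeB ?pmfs_volume_ge0 ?pmfs_volume_le_bound.
Unshelve. all: by end_near. Qed.
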